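(* Let $G \leq A\Gamma L(d,F)$ be a Frattini-free finite $\mathcal{B}$-group, of order $|G| = p^{rd}q^k$, embedded into the general semi-affine group of degree $d$ over the finite field $F=\mathbb{F}_p(\zeta)$ as the subgroup of all elements \[ (v, \zeta^n I, \mathrm{id}_F), \qquad v \in F^d, \quad 0 \le n < q^k, \] where $p \neq q$ are primes, $\zeta$ is a primitive $q^k$th root of unity over $\mathbb{F}_p$ and $[F:\mathbb{F}_p]=r$. Then $G$ is normal in $A\Gamma L(d,F)$ and the action of $A\Gamma L(d,F)$ on $G$ by conjugation induces the full automorphism group of $G$, i.e. the resulting homomorphism $A\Gamma L(d,F) \to \mathrm{Aut}(G)$ is surjective. Moreover, the action of $A\Gamma L(d,F)$ on $G$ is faithful, unless $G$ is abelian.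
   Context: A generating set $X$ of a finite group $G$ is minimal if no proper subset of $X$ generates $G$. A finite group $G$ is called a $\mathcal{B}$-group if all its minimal generating sets have the same size. $G$ is Frattini-free if its Frattini subgroup is trivial. Every Frattini-free finite $\mathcal{B}$-group $G$ has order $p^{rd}q^k$ with $p\ne q$ distinct primes, where the socle $\mathrm{Soc}(G)$ (the subgroup generated by all minimal normal subgroups) is a direct product of $d$ minimal normal subgroups, each elementary abelian of size $p^r$, and $G$ can be realized in the form described in the claim. Here $k \geq 0$; the case $k=0$ (so $\zeta=1$, $F=\mathbb{F}_p$, $r=1$, $G=\mathbb{F}_p^d$) is exactly the case in which $G$ is abelian. The general semi-affine group is $A\Gamma L(d,F) = F^d \rtimes \mathrm{GL}(d,F) \rtimes \mathrm{Aut}(F)$, the group of semi-affine transformations of $F^d$, with $F^d$ acting by translations, $\mathrm{GL}(d,F)$ by linear maps and the group $\mathrm{Aut}(F)$ of field automorphisms coordinatewise; its elements are written as triples $(v,A,\sigma)$. $I$ is the identity matrix in $\mathrm{GL}(d,F)$. *)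

(* Defs.v *)
From HB Require Import structures.
From mathcomp Require Import all_boot all_order all_algebra.
From mathcomp Require Import all_fingroup all_solvable all_field.

Set Implicit Arguments.
Unset Strict Implicit.
Unset Printing Implicit Defensive.

Import GroupScope GRing.Theory.
Local Open Scope ring_scope.

Definition min_genset (gT : finGroupType) (G X : {set gT}) : bool :=
  minset [pred Y : {set gT} | <<Y>>%g == G] X.

Definition B_group (gT : finGroupType) (G : {set gT}) : Prop :=
  forall X Y : {set gT}, min_genset G X -> min_genset G Y -> #|X| = #|Y|.

Definition frattini_free (gT : finGroupType) (G : {set gT}) : Prop :=
  'Phi(G) = 1%g.

Section FieldAut.

Variable F : finFieldType.

Definition field_auts : {set {perm F}} :=
  [set s : {perm F} |
    [&& s 1 == 1,
        [forall x, forall y, s (x + y) == s x + s y]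
      & [forall x, forall y, s (x * y) == s x * s y]]].

Lemma field_autsP (s : {perm F}) :
  reflect [/\ s 1 = 1, {morph s : x y / x + y} & {morph s : x y / x * y}]
          (s \in field_auts).
Proof.
rewrite inE; apply: (iffP and3P) => -[s1 sD sM]; split; try exact/eqP.
- by move=> x y; apply/eqP; move/forallP/(_ x)/forallP/(_ y): sD.
- by move=> x y; apply/eqP; move/forallP/(_ x)/forallP/(_ y): sM.
- by apply/forallP => x; apply/forallP => y; rewrite sD.
- by apply/forallP => x; apply/forallP => y; rewrite sM.
Qed.

Lemma field_auts_group_set : group_set field_auts.
Proof.
apply/group_setP; split=> [|s t /field_autsP[s1 sD sM] /field_autsP[t1 tD tM]].
  by apply/field_autsP; split=> [|x y|x y]; rewrite !perm1.
apply/field_autsP; split=> [|x y|x y]; rewrite !permM ?s1 ?sD ?sM //.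
Qed.
Canonical field_auts_group := Group field_auts_group_set.

(* Aut(F); beware that, as for all permutations, (s * t)%g is t \o s. *)
Definition fieldAut : Type := subg_of field_auts_group.
HB.instance Definition _ := FinGroup.on fieldAut.

Definition faut (s : fieldAut) : F -> F := fun x => sgval s x.

Section Morphism.
Variable s : fieldAut.

Fact faut_zmod_morphism : zmod_morphism (faut s).
Proof.
have [_ sD _] := field_autsP _ (subgP s).
move=> x y; apply: (addIr (faut s y)); rewrite /faut subrK -sD subrK //.
Qed.
HB.instance Definition _ :=
  GRing.isZmodMorphism.Build F F (faut s) faut_zmod_morphism.

Fact faut_monoid_morphism : monoid_morphism (faut s).
Proof. by have [s1 _ sM] := field_autsP _ (subgP s); split. Qed.
HB.instance Definition _ :=
  GRing.isMonoidMorphism.Build F F (faut s) faut_monoid_morphism.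
End Morphism.

Lemma faut1 x : faut 1%g x = x.
Proof. by rewrite /faut perm1. Qed.

Lemma fautM s t x : faut (t * s)%g x = faut s (faut t x).
Proof. by rewrite /faut permM. Qed.

End FieldAut.

Section SemiAffine.

Variables (d : nat) (F : finFieldType).

(* {'GL_d[F]} of the library is made of d.-1.+1 x d.-1.+1 matrices, which is *)
(* wrong for d = 0.                                                          *)
Definition GLmx := {A : 'M[F]_d | A \in unitmx}.
HB.instance Definition _ := Finite.on GLmx.

Definition AGammaL := ('cV[F]_d * GLmx * fieldAut F)%type.
HB.instance Definition _ := Finite.on AGammaL.

Definition semiaffine (v : 'cV[F]_d) (A : 'M[F]_d) (uA : A \in unitmx)
    (s : fieldAut F) : AGammaL :=
  (v, exist _ A uA, s).

Definition sa_trans (g : AGammaL) : 'cV[F]_d := g.1.1.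
Definition sa_lin (g : AGammaL) : 'M[F]_d := val g.1.2.
Definition sa_aut (g : AGammaL) : fieldAut F := g.2.

(* The triple (v, A, s) stands for the map x |-> v + A s(x). *)
Definition sa_act (g : AGammaL) (x : 'cV[F]_d) : 'cV[F]_d :=
  sa_trans g + sa_lin g *m map_mx (faut (sa_aut g)) x.

Lemma sa_lin_unit g : sa_lin g \in unitmx. Proof. exact: valP g.1.2. Qed.

Lemma sa_eq g h :
    sa_trans g = sa_trans h -> sa_lin g = sa_lin h -> sa_aut g = sa_aut h ->
  g = h.
Proof.
case: g h => [[v A] s] [[w B] t] /= ev eA es; congr (_, _, _) => //.
exact/val_inj.
Qed.

Fact GLmx1_subproof : (1%:M : 'M[F]_d) \in unitmx. Proof. exact: unitmx1. Qed.

Fact sa_mul_subproof (g h : AGammaL) :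
  sa_lin g *m map_mx (faut (sa_aut g)) (sa_lin h) \in unitmx.
Proof. by rewrite unitmx_mul sa_lin_unit map_unitmx sa_lin_unit. Qed.

Fact sa_inv_subproof (g : AGammaL) :
  map_mx (faut (sa_aut g)^-1%g) (invmx (sa_lin g)) \in unitmx.
Proof. by rewrite map_unitmx unitmx_inv sa_lin_unit. Qed.

Definition sa_one : AGammaL := semiaffine 0 GLmx1_subproof 1%g.

(* The product is composition of maps, (g * h) x = g (h x), see sa_actM; the *)
(* third component is therefore (sa_aut g) \o (sa_aut h).                    *)
Definition sa_mul (g h : AGammaL) : AGammaL :=
  semiaffine (sa_act g (sa_trans h)) (sa_mul_subproof g h)
             (sa_aut h * sa_aut g)%g.

Definition sa_inv (g : AGammaL) : AGammaL :=
  semiaffine (- map_mx (faut (sa_aut g)^-1%g) (invmx (sa_lin g) *m sa_trans g))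
             (sa_inv_subproof g) (sa_aut g)^-1%g.

Lemma map_faut1 m n (A : 'M[F]_(m, n)) : map_mx (faut 1%g) A = A.
Proof. by apply/matrixP => i j; rewrite !mxE faut1. Qed.

Lemma map_fautM m n s t (A : 'M[F]_(m, n)) :
  map_mx (faut (t * s)%g) A = map_mx (faut s) (map_mx (faut t) A).
Proof. by apply/matrixP => i j; rewrite !mxE fautM. Qed.

Fact sa_mulE (g h : AGammaL) :
  [/\ sa_trans (sa_mul g h) = sa_act g (sa_trans h),
      sa_lin (sa_mul g h) = sa_lin g *m map_mx (faut (sa_aut g)) (sa_lin h)
    & sa_aut (sa_mul g h) = (sa_aut h * sa_aut g)%g].
Proof. by []. Qed.

Fact sa_act_mul g h x : sa_act (sa_mul g h) x = sa_act g (sa_act h x).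
Proof.
rewrite {1}/sa_act; have [-> -> ->] := sa_mulE g h.
by rewrite /sa_act map_fautM map_mxD map_mxM mulmxDr addrA mulmxA.
Qed.

Fact sa_mulA : associative sa_mul.
Proof.
move=> g h k.
have [tgh lgh agh] := sa_mulE g h; have [thk lhk ahk] := sa_mulE h k.
have [t1 l1 a1] := sa_mulE g (sa_mul h k).
have [t2 l2 a2] := sa_mulE (sa_mul g h) k.
apply: sa_eq; first by rewrite t1 t2 thk sa_act_mul.
  by rewrite l1 l2 lhk lgh agh map_mxM mulmxA map_fautM.
by rewrite a1 a2 ahk agh mulgA.
Qed.

Fact sa_oneE :
  [/\ sa_trans sa_one = 0, sa_lin sa_one = 1%:M & sa_aut sa_one = 1%g].
Proof. by []. Qed.

Fact sa_act_one x : sa_act sa_one x = x.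
Proof.
rewrite /sa_act; have [-> -> ->] := sa_oneE.
by rewrite map_faut1 mul1mx add0r.
Qed.

Fact sa_mul1 : left_id sa_one sa_mul.
Proof.
move=> g; have [t l a] := sa_mulE sa_one g; have [_ l1 a1] := sa_oneE.
apply: sa_eq; first by rewrite t sa_act_one.
  by rewrite l l1 a1 map_faut1 mul1mx.
by rewrite a a1 mulg1.
Qed.

Fact sa_invE (g : AGammaL) :
  [/\ sa_trans (sa_inv g) =
        - map_mx (faut (sa_aut g)^-1%g) (invmx (sa_lin g) *m sa_trans g),
      sa_lin (sa_inv g) = map_mx (faut (sa_aut g)^-1%g) (invmx (sa_lin g))
    & sa_aut (sa_inv g) = (sa_aut g)^-1%g].
Proof. by []. Qed.

Fact sa_mulV : left_inverse sa_one sa_inv sa_mul.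
Proof.
move=> g; have [t l a] := sa_mulE (sa_inv g) g.
have [ti li ai] := sa_invE g; have [t1 l1 a1] := sa_oneE.
apply: sa_eq; first by rewrite t t1 /sa_act ti li ai map_mxM addNr.
  by rewrite l l1 li ai -map_mxM mulVmx ?sa_lin_unit // map_mx1.
by rewrite a ai a1 mulgV.
Qed.

HB.instance Definition _ :=
  Finite_isGroup.Build AGammaL sa_mulA sa_mul1 sa_mulV.

Lemma sa_act1 x : sa_act 1%g x = x.
Proof. exact: sa_act_one. Qed.

Lemma sa_actM (g h : AGammaL) x : sa_act (g * h)%g x = sa_act g (sa_act h x).
Proof. exact: sa_act_mul. Qed.

(* The elements (v, zeta^n I, id_F) with v in F^d and 0 <= n < m. *)
Definition scalar_affine (zeta : F) (m : nat) : {set AGammaL} :=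
  [set g | [exists n : 'I_m, sa_lin g == (zeta ^+ n)%:M] & sa_aut g == 1%g].

End SemiAffine.

(* Main.v *)
Require Import Defs.
From HB Require Import structures.
From mathcomp Require Import all_boot all_order all_algebra.
From mathcomp Require Import all_fingroup all_solvable all_field.

Set Implicit Arguments.
Unset Strict Implicit.
Unset Printing Implicit Defensive.

Import GroupScope GRing.Theory.
Local Open Scope ring_scope.

(** If d = 0 then G is trivial, so let d > 0.

    The group G is the semidirect product of the group V of translations tr v
    by the cyclic group generated by the homothety hm of ratio zeta. Normality
    holds because conjugating a homothety by a semi-affine map with field
    automorphism s replaces its ratio c by s c, and s zeta is again a power of
    zeta.

    Surjectivity: let a be an automorphism of G. As q^k is prime to p, the
    elements of G killed by p are exactly the translations, so a permutes V
    and a (tr v) = tr (f v) for an additive bijection f. If zeta^m is the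
    ratio of a hm, applying a to hm * tr v = tr (zeta v) * hm yields
    f (zeta v) = zeta^m f v. Since zeta generates F as a ring, every scalar c
    satisfies f (c v) = s(c) f v for some s(c), and s is then a field
    automorphism ([semilinear_decomposition]); hence f v = A s(v) for some
    invertible A. Only the translation part w of the required element
    (w, A, s) remains to be chosen so that hm is sent to a hm: if u is the
    translation part of a hm this means (1 - zeta^m) w = u, which is solvable
    since zeta^m = 1 forces a hm, hence hm, to be a translation; then hm = 1
    and u = 0.

    Faithfulness: if G is not abelian then zeta <> 1. A map (w, A, s) commuting
    with every tr v satisfies A s(v) = v for all v, that is A = 1 and s = 1; if
    it also commutes with hm, it fixes the only fixed point 0 of hm, so
    w = 0. *)

(** * Semilinear maps *)

(** Elements of the field generated by zeta over its prime subfield are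
    polynomials in zeta with integer coefficients. *)
Lemma prime_adjoin_ind (p : nat) (F : finFieldType) (pcharF : p \in [pchar F])
    (zeta : F) (S : F -> Prop) :
    <<1; (zeta : pPrimeCharType pcharF)>>%VS
      = {: pPrimeCharType pcharF}%VS ->
    S 0 -> S 1 -> S zeta -> (forall x y, S x -> S y -> S (x + y)) ->
    (forall x y, S x -> S y -> S (x * y)) ->
  forall x, S x.
Proof.
move=> gen S0 S1 Sz SD SM x.
have /Fadjoin_polyP[P /polyOver1P[Q ->] ->]:
    (x : pPrimeCharType pcharF) \in <<1; (zeta : pPrimeCharType pcharF)>>%VS.
  by rewrite gen memvf.
rewrite horner_coef.
apply: (big_ind S) => // i _.
rewrite coef_map /=; apply: (SM _ _).
  apply: (SM _ 1) => //; elim: (nat_of_ord _) => [|n IHn] //.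
  by rewrite mulrSr; apply: (SD _ _).
elim: (nat_of_ord i) => [|n IHn]; first by rewrite expr0.
by rewrite exprS; apply: (SM _ _).
Qed.

(** An additive bijection that twists multiplication by a generator of the
    field is semilinear. *)
Lemma semilinear_decomposition (p : nat) (F : finFieldType)
    (pcharF : p \in [pchar F]) (zeta b : F) (d : nat)
    (f : 'cV[F]_d -> 'cV[F]_d) :
    <<1; (zeta : pPrimeCharType pcharF)>>%VS
      = {: pPrimeCharType pcharF}%VS ->
    (0 < d)%N -> {morph f : x y / x + y} -> injective f ->
    (forall x, f (zeta *: x) = b *: f x) ->
  exists s A, [/\ A \in unitmx, faut s zeta = b
                & forall x, f x = A *m map_mx (faut s) x].
Proof.
move=> gen d_gt0 fD f_inj fz.
have f0 : f 0 = 0 by apply: (addIr (f 0)); rewrite -fD !add0r.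
have fZ c : exists e, forall x, f (c *: x) = e *: f x.
  move: c; apply: (prime_adjoin_ind gen) => [|||c1 c2 [e1 E1] [e2 E2]|].
  - by exists 0 => x; rewrite !scale0r.
  - by exists 1 => x; rewrite !scale1r.
  - by exists b.
  - by exists (e1 + e2) => x; rewrite !scalerDl fD E1 E2.
  move=> c1 c2 [e1 E1] [e2 E2].
  by exists (e1 * e2) => x; rewrite -!scalerA E1 E2.
pose x0 : 'cV[F]_d := const_mx 1.
have [i fx0i] : exists i, f x0 i 0 != 0.
  have fx0 : f x0 != 0.
    rewrite -f0 (inj_eq f_inj).
    by apply/eqP => /colP/(_ (Ordinal d_gt0))/eqP; rewrite !mxE oner_eq0.
  apply/existsP; apply: contraNT fx0 => /existsPn fx0.
  by apply/eqP/colP => i; rewrite mxE; apply/eqP; rewrite -[_ == _]negbK.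
pose s0 c := f (c *: x0) i 0 / f x0 i 0.
have fs c x : f (c *: x) = s0 c *: f x.
  by have [e fe] := fZ c; rewrite /s0 !fe mxE mulfK.
have s0_uniq c e : f (c *: x0) = e *: f x0 -> s0 c = e.
  by rewrite /s0 => ->; rewrite mxE mulfK.
have s01 : s0 1 = 1 by apply: s0_uniq; rewrite !scale1r.
have s0D : {morph s0 : c1 c2 / c1 + c2}.
  by move=> c1 c2; apply: s0_uniq; rewrite !scalerDl fD !fs.
have s0M : {morph s0 : c1 c2 / c1 * c2}.
  by move=> c1 c2; apply: s0_uniq; rewrite -scalerA 2!fs scalerA.
have s0_inj : injective s0.
  move=> c1 c2 eqs; have := fs c1 x0; rewrite eqs -fs => /f_inj.
  by move/(congr1 (fun v : 'cV_d => v (Ordinal d_gt0) 0)); rewrite !mxE !mulr1.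
have s_aut : perm s0_inj \in field_auts F.
  by apply/field_autsP; split=> [|c1 c2|c1 c2]; rewrite !permE.
pose s : fieldAut F := subg (field_auts_group F) (perm s0_inj).
have sE c : faut s c = s0 c by rewrite /faut subgK // permE.
pose A : 'M[F]_d := \matrix_(j, l) f (delta_mx l 0) j 0.
have fA x : f x = A *m map_mx (faut s) x.
  rewrite {1}[x]matrix_sum_delta (big_morph f fD f0).
  apply/colP => j; rewrite summxE mxE; apply: eq_bigr => l _.
  by rewrite big_ord_recl big_ord0 addr0 fs !mxE sE mulrC.
exists s, A; split=> //; last by rewrite sE; apply: s0_uniq.
have [g _ gK] := injF_bij f_inj.
pose B : 'M[F]_d := \matrix_(j, l) faut s (g (delta_mx l 0) j 0).
suffices /mulmx1_unit[]: A *m B = 1%:M by [].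
apply/matrixP => j l.
have := gK (delta_mx l 0); rewrite fA => /colP/(_ j); rewrite !mxE eqxx andbT.
by move=> <-; apply: eq_bigr => h _; rewrite !mxE.
Qed.

(** * Translations and homotheties *)

Section ScalarAffine.

Variables (d : nat) (F : finFieldType).
Implicit Types (g h : AGammaL d F) (v : 'cV[F]_d).

Lemma sa_transM g h : sa_trans (g * h)%g = sa_act g (sa_trans h).
Proof. by []. Qed.

Lemma sa_linM g h :
  sa_lin (g * h)%g = sa_lin g *m map_mx (faut (sa_aut g)) (sa_lin h).
Proof. by []. Qed.

Lemma sa_autM g h : sa_aut (g * h)%g = (sa_aut h * sa_aut g)%g.
Proof. by []. Qed.

Lemma sa_trans1 : sa_trans (1%g : AGammaL d F) = 0. Proof. by []. Qed.
Lemma sa_lin1 : sa_lin (1%g : AGammaL d F) = 1%:M. Proof. by []. Qed.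
Lemma sa_aut1 : sa_aut (1%g : AGammaL d F) = 1%g. Proof. by []. Qed.

(** The translation x |-> v + x. *)
Definition tr v : AGammaL d F := semiaffine v (GLmx1_subproof d F) 1%g.

Lemma tr_trans v : sa_trans (tr v) = v. Proof. by []. Qed.
Lemma tr_lin v : sa_lin (tr v) = 1%:M. Proof. by []. Qed.
Lemma tr_aut v : sa_aut (tr v) = 1%g. Proof. by []. Qed.

Lemma tr_inj : injective tr.
Proof. by move=> u v /(congr1 (@sa_trans d F)). Qed.

Lemma trP g : sa_lin g = 1%:M -> sa_aut g = 1%g -> g = tr (sa_trans g).
Proof. by move=> lg ag; apply: sa_eq. Qed.

Lemma trD u v : tr (u + v) = (tr u * tr v)%g.
Proof.
apply: sa_eq; rewrite ?sa_transM ?sa_linM ?sa_autM.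
- by rewrite /sa_act !tr_trans tr_lin tr_aut map_faut1 mul1mx.
- by rewrite !tr_lin map_mx1 mul1mx.
- by rewrite !tr_aut mulg1.
Qed.

Lemma tr0 : tr 0 = 1%g. Proof. exact: sa_eq. Qed.

Lemma trMn v n : tr (v *+ n) = (tr v ^+ n)%g.
Proof. by elim: n => [|n IHn]; rewrite ?tr0 // mulrS trD IHn expgS. Qed.

Lemma tr_pchar p v : p \in [pchar F] -> (tr v ^+ p)%g = 1%g.
Proof.
move=> pcharF; rewrite -trMn -tr0; congr tr; apply/matrixP=> i j.
by rewrite mulmxnE mxE -mulr_natr (pcharf0 pcharF) mulr0.
Qed.

Lemma sa_expn g (c : F) n : sa_lin g = c%:M -> sa_aut g = 1%g ->
  sa_lin (g ^+ n)%g = (c ^+ n)%:M /\ sa_aut (g ^+ n)%g = 1%g.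
Proof.
move=> lg ag; elim: n => [|n [IHl IHa]]; first by rewrite expr0.
rewrite expgS sa_linM sa_autM lg ag IHl IHa map_faut1 -scalar_mxM -exprS.
by rewrite mulg1.
Qed.

Lemma sa_conj_tr g v :
  (g * tr v = tr (sa_lin g *m map_mx (faut (sa_aut g)) v) * g)%g.
Proof.
apply: sa_eq; rewrite ?sa_transM ?sa_linM ?sa_autM.
- by rewrite /sa_act !tr_trans tr_lin tr_aut map_faut1 mul1mx addrC.
- by rewrite !tr_lin map_mx1 tr_aut map_faut1 mul1mx mulmx1.
- by rewrite !tr_aut mulg1 mul1g.
Qed.

(** The homothety x |-> c x. *)
Definition hm (c : F) (uc : c%:M \in unitmx) : AGammaL d F :=
  semiaffine 0 uc 1%g.

Lemma hm_trans (c : F) (uc : c%:M \in unitmx) : sa_trans (hm uc) = 0.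
Proof. by []. Qed.

Lemma hm_lin (c : F) (uc : c%:M \in unitmx) : sa_lin (hm uc) = c%:M.
Proof. by []. Qed.

Lemma hm_aut (c : F) (uc : c%:M \in unitmx) : sa_aut (hm uc) = 1%g.
Proof. by []. Qed.

Lemma hmX_trans (c : F) (uc : c%:M \in unitmx) n :
  sa_trans (hm uc ^+ n)%g = 0.
Proof.
elim: n => [|n IHn] //.
by rewrite expgS sa_transM IHn /sa_act hm_trans map_mx0 mulmx0 addr0.
Qed.

Lemma tr_hmX (c : F) (uc : c%:M \in unitmx) g n :
    sa_lin g = (c ^+ n)%:M -> sa_aut g = 1%g ->
  g = (tr (sa_trans g) * hm uc ^+ n)%g.
Proof.
move=> lg ag; have [lh ah] := sa_expn n (hm_lin uc) (hm_aut uc).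
apply: sa_eq; rewrite ?sa_transM ?sa_linM ?sa_autM.
- by rewrite hmX_trans /sa_act tr_trans map_mx0 mulmx0 addr0.
- by rewrite lh tr_lin tr_aut map_faut1 mul1mx.
- by rewrite ah tr_aut mulg1.
Qed.

(** * The group of translations and homotheties of ratio a power of zeta *)

Variables (zeta : F) (N : nat) (zetaP : N.-primitive_root zeta).

Lemma prim_scalar_unit : (zeta%:M : 'M[F]_d) \in unitmx.
Proof.
rewrite unitmxE det_scalar unitrX // unitfE; apply/eqP => zeta0.
have := prim_expr_order zetaP; rewrite zeta0 expr0n.
by rewrite eqn0Ngt (prim_order_gt0 zetaP) => /esym/eqP; rewrite oner_eq0.
Qed.

Lemma scalar_affineP g :
  reflect (exists2 n, sa_lin g = (zeta ^+ n)%:M & sa_aut g = 1%g)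
          (g \in scalar_affine d zeta N).
Proof.
rewrite inE; apply: (iffP andP) => [[/existsP[n /eqP lg] /eqP ag] | [n lg ag]].
  by exists n.
split; last exact/eqP.
apply/existsP; exists (Ordinal (ltn_pmod n (prim_order_gt0 zetaP))) => /=.
by rewrite (prim_expr_mod zetaP) lg.
Qed.

Lemma tr_in_scalar_affine v : tr v \in scalar_affine d zeta N.
Proof. by apply/scalar_affineP; exists 0. Qed.

Lemma hm_in_scalar_affine : hm prim_scalar_unit \in scalar_affine d zeta N.
Proof. by apply/scalar_affineP; exists 1. Qed.

Lemma scalar_affine_conj g h :
  h \in scalar_affine d zeta N -> (h ^ g)%g \in scalar_affine d zeta N.
Proof.
case/scalar_affineP=> n lh ah; pose s := sa_aut g.
have eqgh : (g * h ^ g = h * g)%g by rewrite -conjgC.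
have sz1 : faut s^-1%g zeta ^+ N = 1.
  by rewrite -rmorphXn (prim_expr_order zetaP) rmorph1.
have [m szE] := prim_rootP zetaP sz1.
apply/scalar_affineP; exists (m * n)%N; last first.
  have /(congr1 (@sa_aut d F)) := eqgh; rewrite !sa_autM ah mulg1 => agh.
  by apply: (mulIg (sa_aut g)); rewrite agh mul1g.
have /(congr1 (@sa_lin d F)) := eqgh; rewrite !sa_linM lh ah map_faut1.
rewrite -scalar_mxC => /(congr1 (mulmx (invmx (sa_lin g)))).
rewrite !mulKmx ?sa_lin_unit // => /(congr1 (map_mx (faut s^-1%g))).
rewrite -map_fautM mulgV map_faut1 map_scalar_mx => ->.
by rewrite /= rmorphXn /= szE exprM.
Qed.

(** As N is prime to p, translations are the only elements killed by p. *)
Lemma scalar_affine_pchar p g : (0 < d)%N -> coprime N p ->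
  g \in scalar_affine d zeta N -> (g ^+ p)%g = 1%g -> g = tr (sa_trans g).
Proof.
move=> d_gt0 coNp /scalar_affineP[n lg ag] gp1; apply: trP => //.
have [] := sa_expn p lg ag; rewrite gp1 sa_lin1 => /matrixP.
move=> /(_ (Ordinal d_gt0) (Ordinal d_gt0)); rewrite !mxE eqxx => zp _.
have: (N %| n * p)%N by rewrite (prim_order_dvd zetaP) exprM -[X in X == _]mulr1n -zp.
by rewrite Gauss_dvdl // (prim_order_dvd zetaP) lg => /eqP->.
Qed.

Variable G : {group AGammaL d F}.
Hypothesis defG : G :=: scalar_affine d zeta N.

(** For d > 0, every automorphism of G is conjugation by a semi-affine map. *)
Lemma scalar_affine_Aut (p : nat) (pcharF : p \in [pchar F])
    (a : {perm AGammaL d F}) :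
    <<1; (zeta : pPrimeCharType pcharF)>>%VS
      = {: pPrimeCharType pcharF}%VS ->
    (0 < d)%N -> coprime N p -> a \in Aut G ->
  exists g, {in G, forall x, a x * g = g * x}%g.
Proof.
move=> gen d_gt0 coNp aG.
have aGin x : x \in G -> a x \in G by apply: Aut_closed.
have aM : {in G &, {morph a : x y / x * y}%g}.
  by apply/morphicP; rewrite inE in aG; case/andP: aG.
have a1 : a 1%g = 1%g by apply: (mulgI (a 1%g)); rewrite -aM ?group1 ?mulg1.
have aX x n : x \in G -> a (x ^+ n)%g = (a x ^+ n)%g.
  by move=> xG; elim: n => [|n IHn] //; rewrite !expgS aM ?groupX // IHn.
have trG v : tr v \in G by rewrite defG tr_in_scalar_affine.
pose z := hm prim_scalar_unit.
have zG : z \in G by rewrite defG hm_in_scalar_affine.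
have pG x : x \in G -> (x ^+ p)%g = 1%g -> x = tr (sa_trans x).
  by rewrite defG; apply: scalar_affine_pchar.
pose f v := sa_trans (a (tr v)).
have atr v : a (tr v) = tr (f v).
  by apply: pG; rewrite ?aGin // -aX // tr_pchar.
have fD : {morph f : u v / u + v}.
  by move=> u v; apply: tr_inj; rewrite trD -!atr trD aM.
have f_inj : injective f.
  by move=> u v eqf; apply/tr_inj/(@perm_inj _ a); rewrite !atr eqf.
have /scalar_affineP[m laz aaz] : a z \in scalar_affine d zeta N.
  by rewrite -defG aGin.
have fz v : f (zeta *: v) = zeta ^+ m *: f v.
  have /(congr1 a) := sa_conj_tr z v.
  rewrite hm_lin hm_aut map_faut1 mul_scalar_mx !aM // !atr sa_conj_tr.
  by move/mulIg/tr_inj; rewrite laz aaz map_faut1 mul_scalar_mx.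
have [s [A [uA sz fE]]] := semilinear_decomposition gen d_gt0 fD f_inj fz.
have [w wE] : exists w, sa_trans (a z) + zeta ^+ m *: w = w.
  have [zm1 | zm1] := eqVneq (zeta ^+ m) 1; last first.
    exists ((1 - zeta ^+ m)^-1 *: sa_trans (a z)).
    set w := _^-1 *: _; have -> : sa_trans (a z) = (1 - zeta ^+ m) *: w.
      by rewrite scalerA divff ?scale1r // subr_eq0 eq_sym.
    by rewrite scalerBl scale1r subrK.
  (* Here a z is a translation, so z is one too, that is z = 1. *)
  exists 0; rewrite scaler0 addr0.
  have aztr : a z = tr (sa_trans (a z)) by apply: trP; rewrite // laz zm1.
  have zp1 : (z ^+ p)%g = 1%g.
    by apply: (@perm_inj _ a); rewrite aX // a1 aztr tr_pchar.
  by rewrite (pG _ zG zp1) tr0 a1.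
pose g : AGammaL d F := semiaffine w uA s.
exists g => x xG; have trv v : (a (tr v) * g = g * tr v)%g.
  by rewrite sa_conj_tr atr fE.
have zv : (a z * g = g * z)%g.
  apply: sa_eq; rewrite ?sa_transM ?sa_linM ?sa_autM.
  - by rewrite /sa_act laz aaz map_faut1 mul_scalar_mx wE map_mx0 mulmx0 addr0.
  - by rewrite laz aaz map_faut1 hm_lin map_scalar_mx /= sz scalar_mxC.
  - by rewrite aaz hm_aut mulg1 mul1g.
have /scalar_affineP[n lx ax]: x \in scalar_affine d zeta N by rewrite -defG.
rewrite (tr_hmX prim_scalar_unit lx ax) aM ?groupX // aX // -/z.
rewrite mulgA -trv -!mulgA; congr mulg.
elim: n {lx} => [|n IHn]; first by rewrite !expg0 mul1g mulg1.
by rewrite !expgS -mulgA IHn mulgA zv -mulgA.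
Qed.

Lemma scalar_affine_cent1 g : ~~ abelian G -> g \in 'C(G)%g -> g = 1%g.
Proof.
move=> nabG /centP cGg.
have trG v : tr v \in G by rewrite defG tr_in_scalar_affine.
pose z := hm prim_scalar_unit.
have zG : z \in G by rewrite defG hm_in_scalar_affine.
have fixv v : sa_lin g *m map_mx (faut (sa_aut g)) v = v.
  apply/tr_inj/(mulIg g); rewrite -sa_conj_tr; exact: cGg.
have lg : sa_lin g = 1%:M.
  apply/matrixP => i j; have /colP/(_ i) := fixv (delta_mx j 0).
  by rewrite map_delta_mx -colE !mxE eqxx andbT.
have zeta_neq1 : zeta%:M != 1%:M :> 'M[F]_d.
  apply: contraNneq nabG => z1.
  have Gtr x : x \in G -> x = tr (sa_trans x).
    rewrite defG => /scalar_affineP[n lx ax]; apply: trP; rewrite // lx.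
    elim: n {lx} => // n IHn; by rewrite exprS scalar_mxM z1 IHn mul1mx.
  by apply/centsP=> x /Gtr-> y /Gtr->; rewrite /commute -!trD addrC.
have d_gt0 : (0 < d)%N.
  by case: posnP zeta_neq1 => // d0 /eqP[]; apply/matrixP; rewrite d0 => -[].
have zeta1 : zeta - 1 != 0.
  by apply: contraNneq zeta_neq1 => /eqP; rewrite subr_eq0 => /eqP->.
apply: sa_eq; rewrite ?sa_trans1 ?sa_aut1 //.
  have /(congr1 (@sa_trans d F)) := cGg z zG.
  rewrite !sa_transM /sa_act hm_trans hm_lin hm_aut map_faut1 mul_scalar_mx.
  rewrite map_mx0 mulmx0 addr0 add0r => zw.
  by apply: (scalerI zeta1); rewrite scalerBl scale1r -zw subrr scaler0.
apply/val_inj/permP => c; rewrite perm1 -[LHS]/(faut (sa_aut g) c).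
have /colP/(_ (Ordinal d_gt0)) := fixv (const_mx c).
by rewrite lg mul1mx !mxE.
Qed.

End ScalarAffine.

Theorem theorem4p1 (p q k r d : nat) (F : finFieldType)
    (pcharF : p \in [pchar F]) (zeta : F) (G : {group AGammaL d F}) :
    prime p -> prime q -> p != q ->
    (q ^ k)%N.-primitive_root zeta ->
    <<1; (zeta : pPrimeCharType pcharF)>>%VS = {: pPrimeCharType pcharF}%VS ->
    \dim {: pPrimeCharType pcharF} = r ->
    G :=: scalar_affine d zeta (q ^ k)%N ->
    #|G| = (p ^ (r * d) * q ^ k)%N ->
    frattini_free G ->
    B_group G ->
  [/\ G <| [set: AGammaL d F],
      (conj_aut G @* [set: AGammaL d F])%g = Aut G
    & ~~ abelian G -> [faithful [set: AGammaL d F], on G | 'J]].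
Proof.
move=> p_pr q_pr neq_pq zetaP gen _ defG _ _ _.
have coNp : coprime (q ^ k)%N p.
  by rewrite coprimeXl // prime_coprime // dvdn_prime2 // eq_sym.
have nG g : g \in 'N(G)%g.
  rewrite inE; apply/subsetP => _ /imsetP[h hG ->].
  by move: hG; rewrite defG; apply: scalar_affine_conj zetaP _ _.
have nGT : [set: AGammaL d F] \subset 'N(G)%g by apply/subsetP=> g _.
split=> [| | nabG]; first by rewrite /normal subsetT nGT.
  apply/eqP; rewrite eqEsubset Aut_conj_aut /=; apply/subsetP => a aG.
  have [d0 | d_gt0] := posnP d.
    have noI : 'I_d -> False by case=> i; rewrite d0.
    have G1 : (G :=: 1)%g.
      apply/trivgP/subsetP => x; rewrite defG inE => /andP[_ /eqP ax].
      apply/set1P; apply: sa_eq; rewrite ?ax //.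
        by apply/colP => i; case: (noI i).
      by apply/matrixP => i; case: (noI i).
    by move: aG; rewrite {1}G1 Aut1 => /set1P->; apply: group1.
  have [g gE] := scalar_affine_Aut zetaP defG gen d_gt0 coNp aG.
  have cgG : conj_aut G g^-1%g \in (conj_aut G @* [set: AGammaL d F])%g.
    by apply: mem_morphim; [apply: nG | rewrite inE].
  (* conj_aut G x is the map y |-> x^-1 * y * x, hence the inverse. *)
  have -> : a = conj_aut G g^-1%g.
    apply: (eq_Aut aG); first exact: (subsetP (Aut_conj_aut G setT)).
    move=> x xG; rewrite norm_conj_autE // conjgE invgK mulgA.
    by apply: (mulIg g); rewrite mulgKV gE.
  exact: cgG.
apply/subsetP => g /setIP[_ cg]; apply/set1P.
apply: (scalar_affine_cent1 zetaP defG nabG).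
by move: cg; rewrite astabJ.
Qed.
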